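(* Let $r>3$ be an integer and let $\delta_0$ be an integer. Suppose that there is a constant $C$ such that $\chi''_{a,r}(G)\leq \Delta(G)+C$ for every graph $G$ with $\delta(G)\geq \delta_0$, or, more weakly, suppose that there is a function $f$ with $f(\Delta)\to 0$ as $\Delta\to\infty$ such that $\chi''_{a,r}(G)\leq (1+f(\Delta(G)))\,\Delta(G)$ for every graph $G$ with $\delta(G)\geq \delta_0$. Then $\delta_0\geq r-1$ if $r\geq 7$, and $\delta_0\geq r-2$ if $r\in\{4,5,6\}$.
   Context: Graphs are finite and simple. For a graph $G=(V,E)$, $\Delta(G)$ and $\delta(G)$ denote its maximum and minimum degrees, $E(v)$ is the set of edges incident with a vertex $v$, and $d(u,v)$ is the distance between $u$ and $v$ in $G$. A proper total colouring of $G$ with $k$ colours is a map $c:E\cup V\to\{1,2,\ldots,k\}$ such that no two adjacent vertices get the same colour, no two edges sharing an endpoint get the same colour, and no edge gets the same colour as one of its endpoints. The pallet of a vertex $v$ under $c$ is $S_c(v):=\{c(e):e\in E(v)\}\cup\{c(v)\}$. For a positive integer $r$, vertices $u,v$ are $r$-neighbours if $1\leq d(u,v)\leq r$. The $r$-distant set distinguishing total number $\chi''_{a,r}(G)$ is the least $k$ for which there is a proper total colouring $c$ of $G$ with $k$ colours such that $S_c(u)\neq S_c(v)$ for every pair of $r$-neighbours $u,v\in V$. *)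

(* Defs.v *)
From mathcomp Require Import all_boot.

Set Implicit Arguments.
Unset Strict Implicit.
Unset Printing Implicit Defensive.

Record sgraph := SGraph {
  vertex :> finType;
  adj : rel vertex;
  adj_sym : symmetric adj;
  adj_irr : irreflexive adj
}.

Definition edges (G : sgraph) : {set {set G}} :=
  [set e | [exists u : G, exists v : G, adj u v && (e == [set u; v])]].

Definition edge (G : sgraph) : finType := {e : {set G} | e \in edges G}.

Definition incident (G : sgraph) (v : G) : {set edge G} :=
  [set e : edge G | v \in val e].

Definition degree (G : sgraph) (v : G) : nat := #|incident v|.

Definition max_degree (G : sgraph) : nat := \max_(v : G) degree v.

(* The default value #|G| exceeds every degree, so this is the true minimum as
   soon as G has a vertex; it is 0 for the null graph. *)
Definition min_degree (G : sgraph) : nat := \big[minn/#|G|]_(v : G) degree v.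

Definition walk (G : sgraph) (u v : G) (n : nat) : bool :=
  [exists p : n.-tuple G, path (@adj G) u p && (last u p == v)].

Lemma connect_walk (G : sgraph) (u v : G) :
  connect (@adj G) u v -> exists n, walk u v n.
Proof.
case/connectP=> p pth ->; exists (size p).
by apply/existsP; exists (in_tuple p); rewrite pth /=.
Qed.

(* None stands for an infinite distance. *)
Definition dist (G : sgraph) (u v : G) : option nat :=
  match @idP (connect (@adj G) u v) with
  | ReflectT uv => Some (ex_minn (connect_walk uv))
  | ReflectF _ => None
  end.

Definition neighbours_upto (G : sgraph) (r : nat) (u v : G) : bool :=
  if dist u v is Some d then 1 <= d <= r else false.

Definition total_colouring (G : sgraph) (k : nat) : finType :=
  {ffun G + edge G -> 'I_k}.

Definition proper_total (G : sgraph) (k : nat) (c : total_colouring G k) : bool :=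
  [&& [forall u : G, forall v : G, adj u v ==> (c (inl u) != c (inl v))],
      [forall e : edge G, forall e' : edge G,
         (e != e') && ~~ [disjoint val e & val e'] ==>
         (c (inr e) != c (inr e'))]
    & [forall v : G, forall e : edge G,
         (v \in val e) ==> (c (inl v) != c (inr e))]].

Definition palette (G : sgraph) (k : nat) (c : total_colouring G k) (v : G) :
    {set 'I_k} :=
  c (inl v) |: [set c (inr e) | e in incident v].

Definition distinguishing (G : sgraph) (r k : nat) (c : total_colouring G k) :
    bool :=
  [forall u : G, forall v : G,
     neighbours_upto r u v ==> (palette c u != palette c v)].

Definition dist_total_colourable (G : sgraph) (r k : nat) : bool :=
  [exists c : total_colouring G k, proper_total c && distinguishing r c].

Lemma neighbours_upto_neq (G : sgraph) r (u v : G) :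
  neighbours_upto r u v -> u != v.
Proof.
rewrite /neighbours_upto /dist; case: {-}_ / idP => // uv.
case: ex_minnP => d _ dmin; apply: contraTneq => equv.
have : d <= 0 by apply/dmin/existsP; exists [tuple]; rewrite /= equv.
by rewrite leqn0 => /eqP->.
Qed.

Lemma dist_total_colourable_ex (G : sgraph) (r : nat) :
  exists k, dist_total_colourable G r k.
Proof.
exists #|{: G + edge G}|.
have inj : injective (@enum_rank (G + edge G)%type) := @enum_rank_inj _.
apply/existsP; exists [ffun x => enum_rank x]; apply/andP; split.
  apply/and3P; split; apply/forallP=> x; apply/forallP=> y; apply/implyP.
  - by rewrite !ffunE (inj_eq inj); apply: contraTneq => -[->]; rewrite adj_irr.
  - by rewrite !ffunE (inj_eq inj) => /andP[xy _]; apply: contra_neq xy => -[].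
  - by rewrite !ffunE (inj_eq inj).
apply/forallP=> u; apply/forallP=> v; apply/implyP=> /neighbours_upto_neq uv.
apply: contraNneq uv => /setP/(_ (enum_rank (inl u : G + edge G))).
rewrite !inE !ffunE eqxx /= => /esym/orP[/eqP/inj[->] //|].
by case/imsetP=> e _; rewrite ffunE => /inj.
Qed.

Definition chi_total_dist (r : nat) (G : sgraph) : nat :=
  ex_minn (dist_total_colourable_ex G r).

(* Main.v *)
(** If the vertices of degree [s] are pairwise at distance at most [r], then their
    palettes are distinct sets of [s + 1] colours, so there are at most
    ['C(k, s + 1)] of them when [k] colours suffice. Many such vertices are
    obtained from the undirected de Bruijn graph on words of length [r - 2] over
    [q] letters, which has diameter at most [r - 2] and maximum degree at most
    [2 q], by attaching to every word ("hub") [b] cliques [K_s], each vertex of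
    which is joined to the hub. With [D = r - 2], [q = D t] and [b s = 2 t], the
    maximum degree is at most [2 (D + 1) t] and there are [2 D^D t^(D + 1)] such
    vertices. For [s = D - 1] this exceeds ['C(k, D)] by a factor of order [t] as
    long as [k] is linear in [t]; for [s = D] it exceeds ['C(k, D + 1)] with [k]
    asymptotically [2 (D + 1) t] because [2^D (D + 1)^D < D^D D!], which holds
    exactly from [D = 5] on. *)

Require Import Defs.
From mathcomp Require Import all_boot zify ring.

Set Implicit Arguments.
Unset Strict Implicit.
Unset Printing Implicit Defensive.

(** * Degrees, palettes and distances *)

Lemma degree_adj (G : sgraph) (v : G) : degree v = #|[set u | adj v u]|.
Proof.
rewrite /degree -(card_imset _ val_inj) -(@card_in_imset _ _ (fun u => [set v; u])).
  congr #|pred_of_set _|; apply/setP=> e; apply/imsetP/imsetP.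
    case=> -[e0 he] /[!inE] /= ve ->; move: (he) => /[!inE] /existsP[x /existsP[y]].
    case/andP=> xy /eqP de; move: ve; rewrite de !inE.
    case/orP=> /eqP vE; first by exists y; rewrite ?inE vE.
    by exists x; rewrite ?inE vE 1?adj_sym// setUC.
  case=> u /[!inE] vu ->.
  have he : [set v; u] \in edges G.
    by rewrite inE; apply/existsP; exists v; apply/existsP; exists u; rewrite vu eqxx.
  by exists (Sub [set v; u] he) => //; rewrite inE /= !inE eqxx.
move=> x y /[!inE] vx vy /setP/(_ x); rewrite !inE eqxx orbT => /esym/orP[]/eqP // xv.
by rewrite xv adj_irr in vx.
Qed.

Lemma card_palette (G : sgraph) k (c : total_colouring G k) (v : G) :
  proper_total c -> #|palette c v| = (degree v).+1.
Proof.
case/and3P=> _ /forallP edgeP /forallP vertP.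
rewrite /palette cardsU1 card_in_imset; last first.
  move=> e e' /[!inE] ve ve' ce; apply/eqP; apply: contraT => ee'.
  have /forallP/(_ e')/implyP := edgeP e.
  rewrite ee' ce eqxx; apply.
  by apply/pred0P => /(_ v) /=; rewrite ve ve'.
suff -> : c (inl v) \notin [set c (inr e) | e in incident v] by [].
apply/imsetP=> -[e /[!inE] ve cv].
by have /forallP/(_ e) := vertP v; rewrite ve cv eqxx.
Qed.

Lemma leq_min_degree (G : sgraph) (v0 : G) s :
  (forall v : G, s <= degree v) -> s <= min_degree G.
Proof.
move=> sG; apply: (big_ind (fun n => s <= n)) => [|m n sm sn|v _] //.
  (* The default value [#|G|] is at least [s] too, because [v0] has at most [#|G|] neighbours. *)
  by rewrite (leq_trans (sG v0))// degree_adj max_card.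
by rewrite leq_min sm.
Qed.

Lemma path_neighbours_upto (G : sgraph) r (u : G) p :
  path (@adj G) u p -> size p <= r -> u != last u p ->
  neighbours_upto r u (last u p).
Proof.
move=> up pr uv; rewrite /neighbours_upto /dist.
case: {-}_ / idP => [c|[]]; last by apply/connectP; exists p.
case: ex_minnP => d /existsP[t /andP[_ tv]] dmin; apply/andP; split.
  case: d t tv {dmin} => // t; rewrite tuple0 /= => /eqP uE.
  by rewrite -uE eqxx in uv.
by rewrite (leq_trans _ pr)// dmin//; apply/existsP; exists (in_tuple p); rewrite /= up /=.
Qed.

Lemma chi_total_dist_colouring r (G : sgraph) :
  exists2 c : total_colouring G (chi_total_dist r G),
    proper_total c & distinguishing r c.
Proof.
by rewrite /chi_total_dist; case: ex_minnP => k /existsP[c /andP[]]; exists c.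
Qed.

Lemma card_distinguished r (G : sgraph) (A : {set G}) s :
  {in A, forall v, degree v = s} ->
  {in A &, forall u v, u != v -> neighbours_upto r u v} ->
  #|A| <= 'C(chi_total_dist r G, s.+1).
Proof.
move=> degA nearA; have [c cP /forallP cD] := chi_total_dist_colouring r G.
rewrite -(@card_in_imset _ _ (palette c) A); last first.
  move=> u v uA vA; apply: contra_eq => uv.
  by have /forallP/(_ v)/implyP := cD u; apply; apply: nearA.
rewrite -[X in 'C(X, _)]card_ord -card_draws; apply/subset_leq_card/subsetP.
by move=> _ /imsetP[v vA ->]; rewrite inE card_palette// degA.
Qed.

(* Consecutive terms may coincide, so the walk can be shorter than [n]. *)
Lemma lazy_walk (T : eqType) (e : rel T) (f : nat -> T) n :
  (forall i, f i = f i.+1 \/ e (f i) (f i.+1)) ->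
  exists p, [/\ path e (f 0) p, last (f 0) p = f n & size p <= n].
Proof.
move=> fP; elim: n => [|n [p [ep lp sp]]]; first by exists [::].
case: (fP n) => [<-|efn]; first by exists p; split=> //; apply: leqW.
by exists (rcons p (f n.+1)); rewrite rcons_path ep lp last_rcons size_rcons.
Qed.

(** * Shifts of words *)

Section DeBruijn.

Variables d q : nat.

Definition word := d.+1.-tuple 'I_q.

Definition shift : rel word := fun u v => behead u == take d v.

(** The first [d] letters of a successor of [u] are prescribed, so its last letter determines it. *)
Lemma card_shift_out u : #|[set v | shift u v]| <= q.
Proof.
have [->|[v0]] := set_0Vmem [set v | shift u v]; first by rewrite cards0.
move=> _; rewrite -[X in _ <= X]card_ord.
apply: (@leq_card_in _ _ (fun v : word => tnth v ord_max)) => v w.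
rewrite !inE => /eqP uv /eqP uw; rewrite !(tnth_nth (thead v0)) /= => vw.
apply/val_inj/(@eq_from_nth _ (thead v0)); rewrite !size_tuple// => i.
rewrite ltnS leq_eqVlt => /predU1P[->//|id].
by rewrite -(nth_take _ id) -uv uw nth_take.
Qed.

Lemma card_shift_in v : #|[set u | shift u v]| <= q.
Proof.
rewrite -[X in _ <= X]card_ord.
apply: (@leq_card_in _ _ (fun v : word => thead v)) => u w.
rewrite !inE => /eqP uv /eqP wv.
case/tupleP: u uv => x u; case/tupleP: w wv => y w /= <- uw; rewrite !theadE => ->.
by apply/val_inj; rewrite /= uw.
Qed.

(** A window of length [d.+1] slides along [u ++ v], from [u] at offset 0 to [v] at offset [d.+1].
    The alternative [u = v] accommodates constant words, which shift to themselves although a simple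
    graph has no loops. *)
Lemma shift_walk (e : rel word) (u v : word) :
  (forall u v, shift u v -> u = v \/ e u v) ->
  exists p, [/\ path e u p, last u p = v & size p <= d.+1].
Proof.
move=> se; pose x0 := thead u.
pose f i : word := [tuple nth x0 (u ++ v) (i + j) | j < d.+1].
have nf i j : j < d.+1 -> nth x0 (f i) j = nth x0 (u ++ v) (i + j).
  by move=> jd; rewrite -[j]/(val (Ordinal jd)) -tnth_nth tnth_mktuple.
have f0 : f 0 = u.
  apply/val_inj/(@eq_from_nth _ x0); rewrite !size_tuple// => i id.
  by rewrite nf// nth_cat size_tuple id.
have fd : f d.+1 = v.
  apply/val_inj/(@eq_from_nth _ x0); rewrite !size_tuple// => i id.
  by rewrite nf// nth_cat size_tuple ltnNge leq_addr/= addKn.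
rewrite -f0 -fd; apply: lazy_walk => i; apply: se.
rewrite /shift; apply/eqP/(@eq_from_nth _ x0).
  by rewrite size_behead size_takel !size_tuple.
move=> j; rewrite size_behead size_tuple /= => jd.
by rewrite nth_behead nth_take// !nf ?addnS// ltnW.
Qed.

End DeBruijn.

(** * The graph of hubs and cliques *)

Section HubGraph.

Variables d q b s : nat.

Local Notation hub := (word d q).
Local Notation low := (hub * 'I_b * 'I_s)%type.

(** A low vertex [l] records its hub, the index of its clique and its place there, so [l.1]
    identifies the clique. *)
Definition hub_adj : rel (hub + low) := fun x y =>
  match x, y with
  | inl u, inl v => (u != v) && (shift u v || shift v u)
  | inl u, inr l => u == l.1.1
  | inr l, inl u => u == l.1.1
  | inr l, inr l' => (l.1 == l'.1) && (l.2 != l'.2)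
  end.

Lemma hub_adj_sym : symmetric hub_adj.
Proof.
move=> [u|l] [v|l'] //=; first by rewrite eq_sym orbC.
by rewrite eq_sym; congr (_ && _); rewrite eq_sym.
Qed.

Lemma hub_adj_irr : irreflexive hub_adj.
Proof. by case=> [u|l] /=; rewrite !eqxx. Qed.

Definition hub_graph : sgraph := SGraph hub_adj_sym hub_adj_irr.

Implicit Types (u v : hub) (l : low).

Lemma degree_low l : 0 < s -> degree (inr l : hub_graph) = s.
Proof.
move=> s0; rewrite degree_adj.
pose K : {set hub_graph} := [set inr (l.1, c) | c in [set~ l.2]].
have inlK u : ((inl u : hub_graph) \in K) = false by apply/imsetP=> -[].
have -> : [set x | @adj hub_graph (inr l) x] = inl l.1.1 |: K.
  apply/setP=> -[u|l']; rewrite !inE /=; first by rewrite inlK orbF.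
  apply/andP/imsetP => [[/eqP ll' ll2]|[c]].
    by exists l'.2; rewrite ?inE 1?eq_sym// ll' -surjective_pairing.
  by rewrite !inE => cl [->] /=; rewrite eqxx eq_sym.
rewrite cardsU1 inlK card_imset; last by move=> c c' [].
by rewrite cardsC1 card_ord add1n prednK.
Qed.

Lemma degree_hub u :
  b * s <= degree (inl u : hub_graph) <= 2 * q + b * s.
Proof.
rewrite degree_adj.
pose L : {set hub_graph} := [set inr (u, x.1, x.2) | x in [set: 'I_b * 'I_s]].
pose H : {set hub_graph} := [set inl v | v in [set v | shift u v] :|: [set v | shift v u]].
have cL : #|L| = b * s.
  rewrite card_imset ?cardsT ?card_prod ?card_ord//.
  by move=> [? ?] [? ?] [-> ->].
have sub : L \subset [set x | @adj hub_graph (inl u) x].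
  by apply/subsetP=> _ /imsetP[x _ ->]; rewrite inE /=.
rewrite -{1}cL subset_leq_card//=.
have /subset_leq_card/leq_trans -> // :
    [set x | @adj hub_graph (inl u) x] \subset H :|: L.
  apply/subsetP=> -[v|[[w j] c]]; rewrite !inE /=.
    by case/andP=> _ uv; apply/orP; left; apply/imsetP; exists v; rewrite ?inE.
  by move/eqP<-; apply/orP; right; apply/imsetP; exists (j, c); rewrite ?inE.
rewrite (leq_trans (leq_card_setU _ _).1)// cL leq_add2r card_imset; last by move=> ? ? [].
by rewrite (leq_trans (leq_card_setU _ _).1)// mul2n -addnn leq_add ?card_shift_out ?card_shift_in.
Qed.

Hypothesis q0 : 0 < q.
Hypothesis b0 : 0 < b.
Hypothesis s0 : 0 < s.

Let w0 : hub := [tuple of nseq d.+1 (Ordinal q0)].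

Lemma min_degree_hub_graph : s <= min_degree hub_graph.
Proof.
apply: (leq_min_degree (inl w0 : hub_graph)) => -[u|l]; last by rewrite degree_low.
by case/andP: (degree_hub u) => + _; apply: leq_trans; rewrite leq_pmull.
Qed.

Lemma max_degree_hub_graph : b * s <= max_degree hub_graph <= 2 * q + b * s.
Proof.
apply/andP; split.
  case/andP: (degree_hub w0) => /leq_trans + _; apply.
  exact: (@leq_bigmax hub_graph (@degree hub_graph) (inl w0)).
apply/bigmax_leqP=> -[u|l] _; first by case/andP: (degree_hub u).
by rewrite degree_low// (leq_trans _ (leq_addl _ _))// leq_pmull.
Qed.

Lemma chi_hub_graph :
  q ^ d.+1 * b * s <= 'C(chi_total_dist d.+3 hub_graph, s.+1).
Proof.
pose A : {set hub_graph} := [set inr l | l in [set: low]].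
have <- : #|A| = q ^ d.+1 * b * s.
  rewrite card_imset; last by move=> ? ? [].
  by rewrite cardsT !card_prod card_tuple !card_ord.
apply: card_distinguished => [_ /imsetP[l _ ->]|]; first exact: degree_low.
move=> _ _ /imsetP[l _ ->] /imsetP[l' _ ->] ll'.
pose e : rel hub := fun u v => (u != v) && (shift u v || shift v u).
have [u v uv|p [ep lp sp]] := @shift_walk d q e l.1.1 l'.1.1.
  by case: (eqVneq u v) => [|nuv]; [left|right; rewrite /e nuv uv].
(* One edge up to the hub, at most [d.+1] shifts, one edge down: at most [d.+3] edges. *)
pose P : seq hub_graph := inl l.1.1 :: rcons [seq inl u | u <- p] (inr l').
have lP : last (inr l : hub_graph) P = inr l' by rewrite /= last_rcons.
rewrite -lP; apply: path_neighbours_upto; rewrite ?lP//.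
  rewrite /= eqxx rcons_path /= path_map; apply/andP; split=> //.
  by rewrite last_map lp /= eqxx.
by rewrite /= size_rcons size_map !ltnS.
Qed.

End HubGraph.

(** * Numerical estimates *)

Lemma ffact_leq_exp n m : n ^_ m <= n ^ m.
Proof.
(* Injections are counted among all functions. *)
rewrite -[n in n ^ _]card_ord -[m in _ ^ m]card_ord -card_ffun.
by rewrite -[in n ^_ _](card_ord n) -[in _ ^_ m](card_ord m) -card_inj_ffuns max_card.
Qed.

Lemma bin_leq_exp n m : 'C(n, m) * m`! <= n ^ m.
Proof. by rewrite bin_ffact ffact_leq_exp. Qed.

(** Induction from [D = 5]. After multiplication by [D ^ D.+1], the inequality
    [D.+2 * D <= D.+1 ^ 2] removes [D.+2], and [2 <= D] absorbs the new factor 2. *)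
Lemma fact_gt_exp D : 4 < D -> 2 ^ D * D.+1 ^ D < D ^ D * D`!.
Proof.
elim: D => // D IH; rewrite ltnS leq_eqVlt => /predU1P[<-//|D4].
have {}IH := IH D4.
have D0 : 0 < D by apply: leq_trans D4.
have sq : D.+2 ^ D.+1 * D ^ D.+1 <= (D.+1 ^ D.+1) * (D.+1 ^ D.+1).
  by rewrite -!expnMn leq_exp2r// mulSn mulnS; nia.
rewrite -(@ltn_pmul2r (D ^ D.+1)) ?expn_gt0 ?D0//.
rewrite -mulnA (leq_ltn_trans (leq_mul (leqnn _) sq))//.
rewrite factS [D ^ D.+1]expnS.
set X := D.+1 ^ D.+1 in sq *.
have -> : X * (D.+1 * D`!) * (D * D ^ D) = X * (D * D.+1) * (D ^ D * D`!) by ring.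
have -> : 2 ^ D.+1 * (X * X) = X * (2 * D.+1) * (2 ^ D * D.+1 ^ D).
  by rewrite {2}/X !expnS; ring.
apply: leq_ltn_trans (_ : _ <= X * (D * D.+1) * (2 ^ D * D.+1 ^ D)) _.
  by rewrite leq_mul2r leq_mul2l leq_mul2r (leq_trans _ D4) ?orbT.
by rewrite ltn_pmul2l// !muln_gt0 D0 expn_gt0.
Qed.

(* From the real asymptotic bound to inequalities between integers *)
From mathcomp Require Import all_order all_algebra.
From mathcomp Require Import all_classical all_reals all_analysis.
Import Order.TTheory GRing.Theory Num.Theory.
Import numFieldNormedType.Exports.
Local Open Scope classical_set_scope.
Local Open Scope ring_scope.

Lemma eventually_chi_lt (R : realType) (r : nat) (P : sgraph -> Prop)
    (f : nat -> R) :
  f @ \oo --> (0 : R) ->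
  (forall G, P G -> (0 < max_degree G)%N ->
    (chi_total_dist r G)%:R <= (1 + f (max_degree G)) * (max_degree G)%:R) ->
  forall A B n : nat, (A < B)%N -> exists M, forall G, P G ->
    (M <= max_degree G)%N ->
    (A * chi_total_dist r G ^ n < B * max_degree G ^ n)%N.
Proof.
move=> f0 fP A B n AB.
have cvgA : A%:R * (1 + f x) ^+ n @[x --> \oo] --> (A%:R * (1 + 0) ^+ n : R).
  apply: cvgM; first exact: (cvg_cst (A%:R : R)).
  apply: (@continuous_cvg _ _ _ _ _ _ (fun x : R => x ^+ n)).
    exact: exprn_continuous.
  by apply: cvgD f0; exact: (cvg_cst (1 : R)).
rewrite addr0 expr1n mulr1 in cvgA.
have ABR : (A%:R : R) < B%:R by rewrite ltr_nat.
have [M _ MP] := cvgr_lt _ cvgA _ ABR.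
(* The degree must be positive for the strict inequality to survive multiplication by its power. *)
exists (maxn 1 M) => G PG; rewrite geq_max => /andP[D0 MD].
have DR : (0 : R) < (max_degree G)%:R by rewrite ltr0n.
rewrite -(ltr_nat R) !natrM !natrX.
apply: le_lt_trans (_ : _ <= A%:R * ((1 + f (max_degree G)) * (max_degree G)%:R) ^+ n) _.
  by rewrite ler_wpM2l// lerXn2r ?nnegrE ?fP// (le_trans _ (fP G PG D0)).
by rewrite exprMn mulrA ltr_pM2r ?exprn_gt0// MP.
Qed.

Lemma cvg_cst_div_nat (R : realType) (C : R) : C / n%:R @[n --> \oo] --> (0 : R).
Proof.
rewrite -[X in _ --> X](mulr0 C); apply: cvgM; first exact: (cvg_cst C).
(* The harmonic sequence is indexed as [1 / (n + 1)], hence the shift. *)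
by rewrite -(cvg_shiftS (fun n => n%:R^-1 : R)); exact: cvg_harmonic.
Qed.

(** * Contradictions from large hub graphs *)

Section LowerBounds.

Variables (r : nat) (P : sgraph -> Prop).

Hypothesis chi_lt : forall A B n : nat, (A < B)%N -> exists M, forall G, P G ->
  (M <= max_degree G)%N -> (A * chi_total_dist r G ^ n < B * max_degree G ^ n)%N.

Lemma large_hub_graph d s A B n M0 : r = d.+3 -> (0 < s)%N -> (A < B)%N ->
  (forall q b, (0 < q)%N -> (0 < b)%N -> P (hub_graph d q b s)) ->
  exists k t, [/\ (M0 <= t)%N, (0 < t)%N,
    ((d.+1 * t) ^ d.+1 * (2 * t) <= 'C(k, s.+1))%N &
    (A * k ^ n < B * (2 * d.+2 * t) ^ n)%N].
Proof.
move=> rE s0 AB PH; have [M MP] := chi_lt n AB.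
(* The factor [s] makes [b * s = 2 * t] solvable in [b]; the maximum puts [t] above [M0] and the
   degree above [M]. *)
pose t := ((maxn 1 (maxn M0 M)) * s)%N.
have t0 : (0 < t)%N by rewrite muln_gt0 s0 leq_max.
have [Mt0 Mt] : (M0 <= t /\ M <= t)%N.
  have [h1 h2] : (M0 <= maxn 1 (maxn M0 M) /\ M <= maxn 1 (maxn M0 M))%N by lia.
  by rewrite /t; split; [apply: leq_trans h1 _|apply: leq_trans h2 _]; rewrite leq_pmulr.
(* Among the choices with [2 * q + b * s <= 2 * d.+2 * t], this one maximises the
   number [q ^ d.+1 * b * s] of low vertices. *)
pose q := (d.+1 * t)%N; pose b := (2 * maxn 1 (maxn M0 M))%N.
have q0 : (0 < q)%N by rewrite muln_gt0.
have b0 : (0 < b)%N by rewrite muln_gt0 leq_max.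
have bs : (b * s = 2 * t)%N by rewrite /b /t mulnA.
exists (chi_total_dist r (hub_graph d q b s)), t; split=> //.
  by rewrite -bs rE mulnA; exact: chi_hub_graph.
have /andP[tD Dt] := max_degree_hub_graph d q0 b0 s0.
have MD : (M <= max_degree (hub_graph d q b s))%N.
  by apply: leq_trans tD; rewrite bs (leq_trans Mt)// leq_pmull.
apply: leq_trans (MP _ (PH q b q0 b0) MD) _.
rewrite leq_mul2l; apply/orP; right.
have [->|n0] := posnP n; first by rewrite !expn0.
rewrite leq_exp2r//; apply: leq_trans Dt _; rewrite bs /q; lia.
Qed.

(** With [A] and [B] the two sides of [fact_gt_exp] for [D = d.+1], the lower and upper bounds on
    [A * k ^ d.+2] are the same number, while one of the inequalities is strict. *)
Lemma not_bounded_dist_minus2 d : r = d.+3 -> (3 < d)%N ->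
  ~ (forall q b, (0 < q)%N -> (0 < b)%N -> P (hub_graph d q b d.+1)).
Proof.
move=> rE d3 PH.
have [k [t [_ t0 tk kt]]] := large_hub_graph d.+2 0 rE (ltn0Sn d) (fact_gt_exp (d3 : 4 < d.+1)%N) PH.
have := leq_ltn_trans (leq_mul (leqnn _) (leq_trans (leq_mul tk (leqnn d.+2`!)) (bin_leq_exp _ _))) kt.
rewrite ltnNge => /negP; apply.
rewrite (factS d.+1) !expnMn !(expnS _ d.+1); apply/eq_leq; ring.
Qed.

(** The palette count grows like [t ^ d.+2], but [k ^ d.+1] only like [t ^ d.+1]. The crude ratio
    [1 < 2] suffices, and [M0] makes [t] outweigh the remaining constant. *)
Lemma not_bounded_dist_minus3 d : r = d.+3 -> (0 < d)%N ->
  ~ (forall q b, (0 < q)%N -> (0 < b)%N -> P (hub_graph d q b d)).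
Proof.
move=> rE d0 PH.
have [k [t [tM t0 tk kt]]] :=
  large_hub_graph d.+1 ((2 * d.+2) ^ d.+1) rE d0 (isT : 1 < 2)%N PH.
have kle : ('C(k, d.+1) <= k ^ d.+1)%N.
  by apply: leq_trans (bin_leq_exp _ _); rewrite leq_pmulr// fact_gt0.
move: kt; rewrite mul1n ltnNge => /negP; apply.
apply: leq_trans (leq_trans tk kle); rewrite !expnMn.
set X := (t ^ d.+1)%N.
have : (0 < d.+1 ^ d.+1)%N by rewrite expn_gt0.
move: tM; rewrite expnMn; move: (_ * _)%N (d.+1 ^ _)%N => Y Z Yt Z0.
have -> : (Z * X * (2 * t) = 2 * (Z * t * X))%N by ring.
by rewrite leq_mul2l leq_mul2r (leq_trans Yt) ?orbT// leq_pmull.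
Qed.

End LowerBounds.

Theorem mainTheorem3 (R : realType) (r : nat) (delta0 : int)
  (r_gt3 : (3 < r)%N)
  (bound :
    (exists C : R, forall G : sgraph, delta0 <= (min_degree G)%:Z ->
       (chi_total_dist r G)%:R <= (max_degree G)%:R + C)
    \/
    (exists f : nat -> R, f @ \oo --> (0 : R) /\
       forall G : sgraph, delta0 <= (min_degree G)%:Z ->
       (chi_total_dist r G)%:R
         <= (1 + f (max_degree G)) * (max_degree G)%:R)) :
  ((7 <= r)%N -> r%:Z - 1 <= delta0) /\
  (r \in [:: 4; 5; 6]%N -> r%:Z - 2 <= delta0).
Proof.
pose P (G : sgraph) := delta0 <= (min_degree G)%:Z.
have {bound} chi_lt (A B n : nat) : (A < B)%N -> exists M, forall G, P G ->
    (M <= max_degree G)%N -> (A * chi_total_dist r G ^ n < B * max_degree G ^ n)%N.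
  case: bound => [[C hC]|[f [f0 fP]]].
    (* The additive bound is the multiplicative one with [f n = C / n]. *)
    apply: (eventually_chi_lt (cvg_cst_div_nat C)) => G PG D0.
    by rewrite mulrDl mul1r divfK ?hC// pnatr_eq0 -lt0n.
  by apply: (eventually_chi_lt f0) => G PG _; exact: fP.
have PH d q b s : (0 < s)%N -> delta0 <= s%:Z -> (0 < q)%N -> (0 < b)%N ->
    P (hub_graph d q b s).
  by move=> s0 ds q0 b0; apply: (le_trans ds); rewrite lez_nat min_degree_hub_graph.
case: r r_gt3 chi_lt => [|[|[|d]]] // d0 chi_lt; split=> rd.
  (* Here [r = d.+3], so failure means [delta0 <= d.+1], and hub graphs with [s = d.+1] are
     admissible; in the second case [s = d]. *)
  rewrite leNgt; apply/negP => dr.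
  apply: (not_bounded_dist_minus2 chi_lt erefl _) => // q b; apply: PH => //; lia.
rewrite leNgt; apply/negP => dr.
apply: (not_bounded_dist_minus3 chi_lt erefl _) => // q b; apply: PH => //; lia.
Qed.
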